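(* Let $(B,\psi)$ be a finite quantum space with $\delta$-form $\psi$, let $\alpha\colon B\to B$ be a $*$-automorphism, and let $E_\alpha$ be the quantum edge correspondence of the quantum graph $\mathcal{G}_\alpha=(B,\psi,\alpha)$. Then the Cuntz--Pimsner algebra of $E_\alpha$ is isomorphic to the crossed product $B\rtimes_\alpha\mathbb{Z}$.
   Context: A finite quantum space $(B,\psi)$ is a finite-dimensional C*-algebra $B$ with a faithful state $\psi$ that is a $\delta$-form, $\delta>0$: if $m\colon B\otimes B\to B$ is multiplication and $m^*\colon B\to B\otimes B$ is its adjoint with respect to the inner products $\langle x,y\rangle_\psi=\psi(x^*y)$ on $B$ and $\langle\cdot,\cdot\rangle_{\psi\otimes\psi}$ on $B\otimes B$, then $mm^*=\delta^2\,\mathrm{id}_B$. A quantum graph $\mathcal{G}=(B,\psi,A)$ is such a space with a linear map $A\colon B\to B$ satisfying $m(A\otimes A)m^*=\delta^2A$; every $*$-homomorphism $\alpha\colon B\to B$ satisfies this. A C*-correspondence over $B$ is a right Hilbert $B$-module $X$ with a $*$-homomorphism $\varphi_X\colon B\to\mathcal{L}(X)$ into the adjointable operators; write $x\cdot\xi=\varphi_X(x)\xi$. $B\otimes_\psi B$ is the C*-correspondence over $B$ with underlying space $B\otimes B$, actions $x\cdot(a\otimes b)\cdot y=(xa)\otimes(by)$ and inner product $\langle a\otimes b,c\otimes d\rangle_B=b^*\psi(a^*c)d$. The quantum edge correspondence of $\mathcal{G}$ is the subcorrespondence $E_{\mathcal{G}}=\mathrm{span}\{x\cdot\epsilon_{\mathcal{G}}\cdot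 y: x,y\in B\}$ of $B\otimes_\psi B$, where $\epsilon_{\mathcal{G}}=\frac{1}{\delta^2}(\mathrm{id}\otimes A)m^*(1_B)$. A representation of a C*-correspondence $X$ over $B$ on a C*-algebra $D$ is a pair $(\pi,t)$ with $\pi\colon B\to D$ a $*$-homomorphism and $t\colon X\to D$ linear such that $\pi(x)t(\xi)=t(x\cdot\xi)$ and $t(\xi)^*t(\eta)=\pi(\langle\xi,\eta\rangle_B)$. With $\theta_{\xi,\eta}(\zeta)=\xi\cdot\langle\eta,\zeta\rangle_B$ generating the compact operators $\mathcal{K}(X)$, let $\psi_t\colon\mathcal{K}(X)\to D$ be the $*$-homomorphism with $\psi_t(\theta_{\xi,\eta})=t(\xi)t(\eta)^*$. The representation is covariant if $\pi(x)=\psi_t(\varphi_X(x))$ for all $x\in J_X=\{x\in B:\varphi_X(x)\in\mathcal{K}(X),\ xy=0\ \forall y\in\ker\varphi_X\}$. The Cuntz--Pimsner algebra is $\mathcal{O}_X=C^*(\pi_X(B),t_X(X))$ where $(\pi_X,t_X)$ is the universal covariant representation. *)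

(* Defs.v *)
(* The scalars are the complex numbers R[i] over
   an arbitrary R : realType, ordered by x <= y iff y - x is real and
   nonnegative; in particular norms take their values in R[i]. *)
From HB Require Import structures.
From mathcomp Require Import all_boot all_order all_algebra.
From mathcomp Require Import ring.
From mathcomp Require Import complex.
From mathcomp Require Import all_classical all_reals.
From mathcomp Require Import topology normedtype.
Set Implicit Arguments.
Unset Strict Implicit.
Unset Printing Implicit Defensive.
Import Order.TTheory GRing.Theory Num.Theory ComplexField.
Import numFieldNormedType.Exports.
Local Open Scope classical_set_scope.
Local Open Scope ring_scope.

Declare Scope cstar_scope.
Delimit Scope cstar_scope with cstar.
Reserved Notation "x ** y" (at level 40, left associativity).

(* C*-algebras need not be unital, so the product is not a MathComp ring
   product. *)
HB.mixin Record isCStarAlgebra (R : realType) A of CompleteNormedModule R[i] A := {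
  cmul : A -> A -> A;
  star : A -> A;
  cmulA : associative cmul;
  cmulDl : left_distributive cmul +%R;
  cmulDr : right_distributive cmul +%R;
  cmulZl : forall (k : R[i]) x y, cmul (k *: x) y = k *: cmul x y;
  cmulZr : forall (k : R[i]) x y, cmul x (k *: y) = k *: cmul x y;
  starK : involutive star;
  starD : {morph star : x y / x + y};
  starZ : forall (k : R[i]) x, star (k *: x) = k^* *: star x;
  starM : forall x y, star (cmul x y) = cmul (star y) (star x);
  normM_le : forall x y, `|cmul x y| <= `|x| * `|y|;
  normCstar : forall x, `|cmul (star x) x| = `|x| ^+ 2 }.

#[short(type="cstarAlgType")]
HB.structure Definition CStarAlgebra (R : realType) :=
  {A of isCStarAlgebra R A & CompleteNormedModule R[i] A}.

Notation "x ** y" := (cmul x y) : cstar_scope.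
Local Open Scope cstar_scope.

HB.mixin Record hasCUnit (R : realType) A of CStarAlgebra R A := {
  cone : A;
  cmul1x : left_id cone cmul;
  cmulx1 : right_id cone cmul }.

#[short(type="unitalCStarAlgType")]
HB.structure Definition UnitalCStarAlgebra (R : realType) :=
  {A of hasCUnit R A & CStarAlgebra R A}.

(* A finite-dimensional C*-algebra is automatically unital; the (unique) unit
   is part of the structure. *)
#[short(type="fdCStarAlgType")]
HB.structure Definition FdCStarAlgebra (R : realType) :=
  {A of UnitalCStarAlgebra R A & Vector R[i] A}.

Section StarHom.
Variable R : realType.

Definition star_hom (A D : cstarAlgType R) (f : A -> D) : Prop :=
  [/\ linear f, {morph f : x y / x ** y} & {morph f : x / star x}].

Definition star_isomorphic (A D : cstarAlgType R) : Prop :=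
  exists f : A -> D, star_hom f /\ bijective f.

Definition cstar_subalgebra (A : cstarAlgType R) (S : set A) : Prop :=
  [/\ closed S, S 0,
      (forall (k : R[i]) x y, S x -> S y -> S (k *: x + y)),
      (forall x y, S x -> S y -> S (x ** y))
    & (forall x, S x -> S (star x))].

Definition cstar_gen (A : cstarAlgType R) (G : set A) : set A :=
  smallest (@cstar_subalgebra A) G.

Definition cinvertible (A : unitalCStarAlgType R) (x : A) : Prop :=
  exists y, x ** y = cone /\ y ** x = cone.

(* Self-adjoint with spectrum contained in [0, +oo[. *)
Definition positive (A : unitalCStarAlgType R) (x : A) : Prop :=
  star x = x /\
  forall k : R[i], ~ cinvertible (x - k *: (cone : A)) -> 0 <= k.

Definition unitary (A : unitalCStarAlgType R) (u : A) : Prop :=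
  star u ** u = cone /\ u ** star u = cone.

End StarHom.

Definition hnorm (R : realType) (B : cstarAlgType R) (X : Type)
  (ip : X -> X -> B) (xi : X) : R[i] := sqrtC `|ip xi xi|.

(* A C*-correspondence over B.  The inner product is linear in the second
   variable.  By lact_adj every lact x is adjointable with adjoint
   lact (star x), so the lact_* axioms say that lact is a *-homomorphism from B
   to L(X). *)
Record correspondence (R : realType) (B : unitalCStarAlgType R) := Correspondence {
  corr_sort :> lmodType R[i];
  ract : corr_sort -> B -> corr_sort;
  ip : corr_sort -> corr_sort -> B;
  lact : B -> corr_sort -> corr_sort;
  ract_linearl : forall b, linear (ract^~ b);
  ract_linearr : forall xi, linear (ract xi);
  ractM : forall xi b c, ract xi (b ** c) = ract (ract xi b) c;
  ract1 : forall xi, ract xi cone = xi;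
  ip_linear : forall xi, linear (ip xi);
  ip_ract : forall xi eta b, ip xi (ract eta b) = ip xi eta ** b;
  ip_star : forall xi eta, star (ip xi eta) = ip eta xi;
  ip_positive : forall xi, positive (ip xi xi);
  ip_definite : forall xi, ip xi xi = 0 -> xi = 0;
  corr_complete : forall u : nat -> corr_sort,
    (forall e : R[i], 0 < e -> exists N, forall m n, (N <= m)%N -> (N <= n)%N ->
       hnorm ip (u m - u n) < e) ->
    exists l, forall e : R[i], 0 < e -> exists N, forall n, (N <= n)%N ->
       hnorm ip (u n - l) < e;
  lact_linearl : forall xi, linear (lact^~ xi);
  lact_linearr : forall x, linear (lact x);
  lactM : forall x y xi, lact (x ** y) xi = lact x (lact y xi);
  lact_adj : forall x xi eta, ip (lact x xi) eta = ip xi (lact (star x) eta) }.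

Section CuntzPimsner.
Variables (R : realType) (B : unitalCStarAlgType R) (X : correspondence B).

Definition is_adjoint (T S : X -> X) : Prop :=
  forall xi eta : X, ip (T xi) eta = ip xi (S eta).

Definition adjointable (T : X -> X) : Prop := exists S, is_adjoint T S.

Definition theta (xi eta : X) : X -> X := fun zeta => ract xi (ip eta zeta).

(* The span of the theta xi eta (scalars can be absorbed in xi). *)
Definition finite_rank (T : X -> X) : Prop :=
  exists s : seq (X * X), T = (fun zeta => \sum_(p <- s) theta p.1 p.2 zeta).

(* K(X) is the closure of the finite rank operators in operator norm. *)
Definition compact_op (T : X -> X) : Prop :=
  adjointable T /\
  forall e : R[i], 0 < e -> exists F, finite_rank F /\
    forall zeta, hnorm (@ip R B X) (T zeta - F zeta)
                   <= e * hnorm (@ip R B X) zeta.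

Definition katsura_ideal (x : B) : Prop :=
  compact_op (lact x) /\
  forall y, (forall xi : X, lact y xi = 0) -> x ** y = 0.

Definition representation (D : cstarAlgType R) (pi : B -> D) (t : X -> D) : Prop :=
  [/\ star_hom pi, linear t,
      (forall x xi, pi x ** t xi = t (lact x xi))
    & (forall xi eta, star (t xi) ** t eta = pi (ip xi eta))].

(* f restricts to the *-homomorphism psi_t : K(X) -> D; its values at
   non-compact operators are irrelevant. *)
Definition is_psi (D : cstarAlgType R) (t : X -> D) (f : (X -> X) -> D) : Prop :=
  [/\ (forall (k : R[i]) S T, compact_op S -> compact_op T ->
         f (fun zeta => k *: S zeta + T zeta) = k *: f S + f T),
      (forall S T, compact_op S -> compact_op T -> f (S \o T) = f S ** f T),
      (forall S T, compact_op S -> compact_op T -> is_adjoint S T ->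
         f T = star (f S))
    & (forall xi eta, f (theta xi eta) = t xi ** star (t eta))].

Definition covariant_rep (D : cstarAlgType R) (pi : B -> D) (t : X -> D) : Prop :=
  representation pi t /\
  exists2 f, is_psi t f & forall x, katsura_ideal x -> pi x = f (lact x).

Definition is_cuntz_pimsner (O : cstarAlgType R) : Prop :=
  exists (pi : B -> O) (t : X -> O),
    [/\ covariant_rep pi t,
        cstar_gen (range pi `|` range t) = [set: O]
      & forall (D : cstarAlgType R) (pi' : B -> D) (t' : X -> D),
          covariant_rep pi' t' ->
          exists! rho : O -> D,
            [/\ star_hom rho, (forall x, rho (pi x) = pi' x)
              & (forall xi, rho (t xi) = t' xi)]].

End CuntzPimsner.

Section CrossedProduct.
Variables (R : realType) (B : unitalCStarAlgType R) (alpha : B -> B).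

(* Unital covariant representations of the action of Z generated by alpha. *)
Definition covariant_pair (D : unitalCStarAlgType R) (pi : B -> D) (u : D) : Prop :=
  [/\ star_hom pi, pi cone = cone, unitary u
    & forall x, u ** pi x ** star u = pi (alpha x)].

(* C is the crossed product of B by Z: the universal unital C*-algebra
   generated by B and a unitary implementing alpha. *)
Definition is_crossed_product (C : unitalCStarAlgType R) : Prop :=
  exists (iota : B -> C) (u : C),
    [/\ covariant_pair iota u,
        cstar_gen (range iota `|` [set u]) = [set: C]
      & forall (D : unitalCStarAlgType R) (pi : B -> D) (v : D),
          covariant_pair pi v ->
          exists! rho : C -> D,
            [/\ star_hom rho, rho cone = cone, (forall x, rho (iota x) = pi x)
              & rho u = v]].

End CrossedProduct.

(* B (x) B for finite-dimensional B, in coordinates: a tensor is the matrix of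
   its coefficients in the basis e_i (x) e_j, where e = vbasis {:B}. *)
Section Tensor.
Variables (R : realType) (B : fdCStarAlgType R).

Definition tensor := 'M[R[i]]_(\dim {:B}).
HB.instance Definition _ := Vector.on tensor.

Definition bvec (i : 'I_(\dim {:B})) : B := (vbasis {:B})`_i.
Definition bcoord (i : 'I_(\dim {:B})) (a : B) : R[i] := coord (vbasis {:B}) i a.

Definition tens (a b : B) : tensor := \matrix_(i, j) (bcoord i a * bcoord j b).

(* The linear map on B (x) B induced by a bilinear map f. *)
Definition tlift (V : lmodType R[i]) (f : B -> B -> V) (T : tensor) : V :=
  \sum_i \sum_j T i j *: f (bvec i) (bvec j).

(* The sesquilinear map on B (x) B induced by h, where h a b c d is conjugate
   linear in a, b and linear in c, d. *)
Definition tlift2 (V : lmodType R[i]) (h : B -> B -> B -> B -> V)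
    (T S : tensor) : V :=
  \sum_i \sum_j \sum_k \sum_l
    ((T i j)^* * S k l) *: h (bvec i) (bvec j) (bvec k) (bvec l).

Definition tmul : tensor -> B := tlift (fun a b => a ** b).

Definition tmap (f g : B -> B) : tensor -> tensor :=
  tlift (fun a b => tens (f a) (g b)).

Definition ip_psi2 (psi : B -> R[i]) : tensor -> tensor -> R[i] :=
  tlift2 (fun a b c d => psi (star a ** c) * psi (star b ** d) : R[i]^o).

(* x . T, T . y and <T, S>_B in B (x)_psi B; see tlact_tens, tract_tens and
   tip_tens for their values on elementary tensors. *)
Definition tlact (x : B) : tensor -> tensor := tmap (fun a => x ** a) id.
Definition tract (T : tensor) (y : B) : tensor := tmap id (fun b => b ** y) T.
Definition tip (psi : B -> R[i]) : tensor -> tensor -> B :=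
  tlift2 (fun a b c d => psi (star a ** c) *: (star b ** d)).

End Tensor.

(* fqs_mstar is the adjoint of the multiplication, which is unique since the
   inner product ip_psi2 fqs_psi is nondegenerate. *)
Record finite_quantum_space (R : realType) (B : fdCStarAlgType R) :=
  FiniteQuantumSpace {
  fqs_psi : {scalar B};
  fqs_delta : R;
  fqs_mstar : B -> tensor B;
  fqs_psi_ge0 : forall x, 0 <= fqs_psi (star x ** x);
  fqs_psi1 : fqs_psi cone = 1;
  fqs_faithful : forall x, fqs_psi (star x ** x) = 0 -> x = 0;
  fqs_delta_gt0 : 0 < fqs_delta;
  fqs_mstar_adj : forall x T,
    ip_psi2 fqs_psi (fqs_mstar x) T = fqs_psi (star x ** tmul T);
  fqs_delta_form : forall x,
    tmul (fqs_mstar x) = (fqs_delta ^+ 2)%:C%C *: x }.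

Record quantum_graph (R : realType) (B : fdCStarAlgType R) := QuantumGraph {
  qg_space :> finite_quantum_space B;
  qg_adj : {linear B -> B};
  qg_schur : forall x,
    tmul (tmap qg_adj qg_adj (fqs_mstar qg_space x)) =
      (fqs_delta qg_space ^+ 2)%:C%C *: qg_adj x }.

Section LinearHelpers.
Variables (K : numClosedFieldType) (U V : lmodType K).

Lemma lin_comb (f : U -> V) (I : Type) (r : seq I) (c : I -> K) (v : I -> U) :
  linear f -> f (\sum_(i <- r) c i *: v i) = \sum_(i <- r) c i *: f (v i).
Proof.
move=> fL; have f0 : f 0 = 0.
  by have := fL (-1) 0 0; rewrite scaler0 addr0 scaleN1r addNr.
elim: r => [|i r IH]; first by rewrite !big_nil.
by rewrite !big_cons fL IH.
Qed.

Lemma clin_comb (f : U -> V) (I : Type) (r : seq I) (c : I -> K) (v : I -> U) :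
  (forall k x y, f (k *: x + y) = k^* *: f x + f y) ->
  f (\sum_(i <- r) c i *: v i) = \sum_(i <- r) (c i)^* *: f (v i).
Proof.
move=> fL; have f0 : f 0 = 0.
  by have := fL (-1) 0 0; rewrite scaler0 addr0 rmorphN1 scaleN1r addNr.
elim: r => [|i r IH]; first by rewrite !big_nil.
by rewrite !big_cons fL IH.
Qed.

End LinearHelpers.

Section Frames.
Variables (K : numClosedFieldType) (V : vectType K) (h : V -> V -> K).
Hypothesis hL : forall x, scalar (h x).
Hypothesis hC : forall x y, h x y = (h y x)^*.
Hypothesis h_ge0 : forall x, 0 <= h x x.
Hypothesis h_def : forall x, h x x = 0 -> x = 0.

(* A Parseval frame of U: by Gram-Schmidt it can be chosen to extend a frame of
   a smaller subspace. *)
Definition frame (U : {vspace V}) (s : seq V) : Prop :=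
  (forall f, f \in s -> f \in U) /\
  (forall v, v \in U -> v = \sum_(f <- s) h f v *: f).

Lemma form0 x : h x 0 = 0.
Proof. by have := hL x (-1) 0 0; rewrite scaler0 addr0 mulN1r addNr. Qed.
Lemma formD x y z : h x (y + z) = h x y + h x z.
Proof. by have := hL x 1 y z; rewrite scale1r mul1r. Qed.
Lemma formZ x k y : h x (k *: y) = k * h x y.
Proof. by have := hL x k y 0; rewrite form0 !addr0. Qed.
Lemma form_sum x (I : Type) (r : seq I) (F : I -> V) :
  h x (\sum_(i <- r) F i) = \sum_(i <- r) h x (F i).
Proof. exact: (big_morph (h x) (formD x) (form0 x)). Qed.

Lemma frame_parseval U s u v : frame U s -> v \in U ->
  h u v = \sum_(f <- s) (h f u)^* * h f v.
Proof.
move=> [_ sF] vU; rewrite {1}(sF v vU) form_sum; apply: eq_bigr => f _.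
by rewrite formZ mulrC [in LHS]hC.
Qed.

Lemma frame_step U s x : frame U s -> exists s', frame (<[x]> + U)%VS s' /\ {subset s <= s'}.
Proof.
move=> sF; have [sU sP] := sF.
pose x' := x - \sum_(f <- s) h f x *: f.
have pU : \sum_(f <- s) h f x *: f \in U.
  by rewrite big_seq; apply: memv_suml => f fs; rewrite memvZ ?sU.
have xE : x = x' + \sum_(f <- s) h f x *: f by rewrite subrK.
have ortho f : f \in U -> h f x' = 0.
  move=> fU; rewrite /x' formD -scaleN1r formZ form_sum.
  rewrite [h f x](_ : _ = \sum_(g <- s) h f (h g x *: g)) ?mulN1r ?subrr//.
  rewrite hC (frame_parseval x sF fU) rmorph_sum; apply: eq_bigr => g _.
  by rewrite rmorphM /= conjCK formZ -hC.
have decomp v : v \in (<[x]> + U)%VS -> exists a w, v = a *: x' + w /\ w \in U.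
  move/memv_addP => [u /vlineP[a ->] [w wU ->]].
  exists a, (a *: (\sum_(f <- s) h f x *: f) + w).
  by rewrite addrA -scalerDr -xE; split=> //; rewrite memvD ?memvZ.
have [x0|xn0] := eqVneq x' 0.
  exists s; split=> //; split.
    by move=> f fs; apply: (subvP (addvSr _ _)); exact: sU.
  by move=> v /decomp[a [w [-> wU]]]; rewrite x0 scaler0 add0r; exact: sP.
have hx : 0 < h x' x'.
  by rewrite lt_neqAle h_ge0 andbT eq_sym; apply: contra_neq xn0; exact: h_def.
pose c := (sqrtC (h x' x'))^-1.
have cR : c^* = c.
  by apply/CrealP; rewrite rpredV; apply: sqrtC_real; exact: ltW.
have cc : c * c * h x' x' = 1.
  by rewrite /c -expr2 exprVn sqrtCK mulVf // gt_eqF.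
exists ((c *: x') :: s); split; last by move=> f fs; rewrite in_cons fs orbT.
have x'U : x' \in (<[x]> + U)%VS.
  rewrite /x' memvB //; first by apply: (subvP (addvSl _ _)); exact: memv_line.
  exact: (subvP (addvSr _ _)).
split.
  move=> f; rewrite in_cons => /orP[/eqP->|fs]; first by rewrite memvZ.
  by apply: (subvP (addvSr _ _)); exact: sU.
move=> v /decomp[a [w [-> wU]]]; rewrite big_cons.
have hcw : h (c *: x') w = 0.
  by rewrite hC formZ (ortho w wU) mulr0 rmorph0.
have hcx : h (c *: x') x' = c * h x' x'.
  by rewrite hC formZ rmorphM /= -hC cR.
rewrite formD formZ hcw addr0 hcx scalerA.
rewrite (_ : a * (c * h x' x') * c = a); last first.
  by rewrite -mulrA [c * _ * c]mulrAC cc mulr1.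
congr (_ + _); rewrite {1}(sP w wU) big_seq [RHS]big_seq.
apply: eq_bigr => f fs.
by rewrite formD formZ ortho ?sU // mulr0 add0r.
Qed.

Lemma frame_span U s (X : seq V) : frame U s ->
  exists s', frame (<<X>> + U)%VS s' /\ {subset s <= s'}.
Proof.
move=> sF; elim: X => [|x X [s1 [s1F ss1]]].
  by exists s; rewrite span_nil add0v; split.
have [s2 [s2F s12]] := frame_step x s1F.
exists s2; rewrite span_cons -addvA; split=> // f /ss1; exact: s12.
Qed.

Lemma frame_full : exists s, frame fullv s.
Proof.
have F0 : frame 0%VS [::].
  by split=> // v; rewrite memv0 big_nil => /eqP.
have [s [sF _]] := frame_span (vbasis fullv) F0.
exists s; move: sF; rewrite addv0 (span_basis (vbasisP _)); done.
Qed.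

Lemma frame_full1 x : h x x = 1 -> exists s, frame fullv s /\ x \in s.
Proof.
move=> hx.
have F1 : frame <[x]> [:: x].
  split=> [f|v /vlineP[k ->]]; first by rewrite inE => /eqP ->; exact: memv_line.
  by rewrite big_seq1 formZ hx mulr1.
have [s [sF xs]] := frame_span (vbasis fullv) F1.
exists s; split; last by apply: xs; rewrite inE.
move: sF; rewrite (span_basis (vbasisP _)).
by rewrite (_ : (fullv + <[x]>)%VS = fullv) //; apply/addv_idPl/subvf.
Qed.

Lemma form_coord_le U s f v : frame U s -> f \in s -> v \in U ->
  `|h f v| ^+ 2 <= h v v.
Proof.
move=> sF fs vU; rewrite (frame_parseval v sF vU).
rewrite (big_rem f) //= normCKC -[leLHS]addr0; apply: lerD => //.
by apply: sumr_ge0 => g _; rewrite -normCKC exprn_ge0.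
Qed.

End Frames.

Section Bounded.
Variables (R : realType) (B : fdCStarAlgType R).
Local Notation K := R[i].

Lemma cmul0x (x : B) : (0 : B) ** x = 0.
Proof. by have := cmulZl 0 (0 : B) x; rewrite !scale0r. Qed.
Lemma cmulx0 (x : B) : x ** (0 : B) = 0.
Proof. by have := cmulZr 0 x (0 : B); rewrite !scale0r. Qed.

Lemma cmul_linl (y : B) : linear (fun x : B => x ** y).
Proof. by move=> k a b; rewrite cmulDl cmulZl. Qed.
Lemma cmul_linr (x : B) : linear (fun y : B => x ** y).
Proof. by move=> k a b; rewrite cmulDr cmulZr. Qed.

Lemma bvec_span (a : B) : a = \sum_i bcoord i a *: bvec i.
Proof. exact: (coord_vbasis (memvf a)). Qed.

Lemma bcoord_bvec i j : bcoord j (bvec i : B) = (i == j)%:R.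
Proof. by rewrite /bcoord /bvec coord_free // (basis_free (vbasisP _)). Qed.

Lemma bcoord_lin i : scalar (@bcoord R B i).
Proof. by move=> k a b; rewrite /bcoord linearP. Qed.

(* The matrix of left multiplication by a (acting on row vectors). *)
Definition lmx (a : B) : 'M[K]_(\dim {:B}) := \matrix_(i, j) bcoord j (a ** bvec i).

Lemma lmxE a i : a ** bvec i = \sum_j lmx a i j *: (bvec j : B).
Proof.
by rewrite {1}[a ** _]bvec_span; apply: eq_bigr => j _; rewrite mxE.
Qed.

Lemma lmx_eigen a k : eigenvalue (lmx a) k -> `|k| <= `|a|.
Proof.
move=> /eigenvalueP[v vE vn0]; pose y : B := \sum_i v 0 i *: bvec i.
have cy i : bcoord i y = v 0 i.
  by rewrite /bcoord /y /bvec coord_sum_free // (basis_free (vbasisP _)).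
have yn0 : y != 0.
  apply: contra_neq vn0 => y0; apply/rowP => i.
  by rewrite -cy y0 /bcoord linear0 mxE.
have ayE : a ** y = k *: y.
  rewrite /y (lin_comb _ _ _ (cmul_linr a)) scaler_sumr.
  under eq_bigr do rewrite lmxE scaler_sumr.
  rewrite exchange_big /=; apply: eq_bigr => j _.
  have := congr1 (fun w : 'rV_ _ => w 0 j) vE; rewrite !mxE => vEj.
  rewrite scalerA -vEj scaler_suml; apply: eq_bigr => i _.
  by rewrite scalerA.
have := normM_le a y; rewrite ayE normrZ ler_pM2r // normr_gt0 //.
Qed.

Lemma lmx_trace_le a : `|\tr (lmx a)| <= `|a| *+ \dim {:B}.
Proof.
have [n0|n0] := posnP (\dim {:B}).
  have -> : \tr (lmx a) = 0.
    by apply: big1 => i _; have := ltn_ord i; rewrite {2}n0.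
  by rewrite normr0 n0 mulr0n.
have pm := char_poly_monic (lmx a).
have [r rE] := closed_field_poly_normal (char_poly (lmx a)).
rewrite (monicP pm) scale1r in rE.
have sr : size r = \dim {:B}.
  have := size_char_poly (lmx a); rewrite rE size_prod_XsubC; by case.
have trE : \tr (lmx a) = \sum_(z <- r) z.
  apply: oppr_inj; rewrite -char_poly_trace // rE -coefPn_prod_XsubC sr //.
  by rewrite -lt0n.
have {}key z : z \in r -> `|z| <= `|a|.
  move=> zr; apply: lmx_eigen; rewrite eigenvalue_root_char rE.
  by rewrite root_prod_XsubC.
rewrite trE -sr; elim: (r) key => [|z r' IH] key.
  by rewrite big_nil normr0.
rewrite big_cons /= mulrS; apply: (le_trans (ler_normD _ _)); apply: lerD.
  by apply: key; rewrite inE eqxx.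
by apply: IH => w wr; apply: key; rewrite inE wr orbT.
Qed.

End Bounded.

Section QuantumSpace.
Variables (R : realType) (B : fdCStarAlgType R) (Q : finite_quantum_space B).
Local Notation K := R[i].
Local Notation psi := (fqs_psi Q).

Definition psi_ip (x y : B) : K := psi (star x ** y).

Lemma psi_ipL x : scalar (psi_ip x).
Proof. by move=> k a b; rewrite /psi_ip cmulDr cmulZr linearP. Qed.

Lemma psi_ipC x y : psi_ip x y = (psi_ip y x)^*.
Proof.
have sq (k : K) : k * psi_ip x y + k^* * psi_ip y x \is Num.real.
  have h z : psi_ip z z \is Num.real by apply: ger0_real; exact: fqs_psi_ge0.
  have := h (x + k *: y).
  rewrite /psi_ip starD starZ !cmulDl !cmulDr !cmulZl !cmulZr !linearD !linearZ /=.
  rewrite -!/(psi_ip _ _).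
  rewrite [X in X \is _](_ : _ = (psi_ip x x + k^* * (k * psi_ip y y)) +
    (k * psi_ip x y + k^* * psi_ip y x)); last first.
    by ring.
  rewrite rpredDl //; apply: rpredD => //.
  by rewrite mulrA -normCKC rpredM // ?rpredX // normr_real.
have /CrealP h1 := sq 1; have /CrealP hi := sq 'i.
set a := psi_ip x y in h1 hi *; set b := psi_ip y x in h1 hi *.
rewrite !rmorph1 !mul1r rmorphD /= in h1.
rewrite !rmorphD !rmorphM /= !conjCK conjCi in hi.
have {}hi : - a^* + b^* = a - b.
  apply: (mulfI (neq0Ci K)); rewrite [RHS](_ : _ = 'i * a + - 'i * b); last ring.
  by rewrite -hi; ring.
apply: (mulfI (_ : 2 != 0 :> K)); first by rewrite pnatr_eq0.
rewrite (_ : 2 * b^* = (a^* + b^*) + (- a^* + b^*)); last ring.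
by rewrite h1 hi; ring.
Qed.

Lemma psi_ip_ge0 x : 0 <= psi_ip x x.
Proof. exact: fqs_psi_ge0. Qed.
Lemma psi_ip_def x : psi_ip x x = 0 -> x = 0.
Proof. exact: fqs_faithful. Qed.

Lemma star_cone (A : unitalCStarAlgType R) : star (cone : A) = cone.
Proof. by rewrite -[LHS]cmulx1 -{2}[cone]starK -starM cmulx1 starK. Qed.

Lemma psi_le (a : B) :
  (forall y, 0 <= psi_ip y (a ** y)) -> psi a <= `|a| *+ \dim {:B}.
Proof.
move=> a_ge0.
have h1 : psi_ip cone cone = 1.
  by rewrite /psi_ip star_cone cmul1x fqs_psi1.
have [s [[sU sF] s1]] := frame_full1 psi_ipL psi_ipC psi_ip_ge0 psi_ip_def h1.
have psiE : psi a = psi_ip cone (a ** cone).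
  by rewrite /psi_ip star_cone cmul1x cmulx1.
have trE : \sum_(f <- s) psi_ip f (a ** f) = \tr (lmx a).
  under eq_bigr => f _.
    rewrite {2}[f]bvec_span (lin_comb _ _ _ (cmul_linr a)) (form_sum psi_ipL).
    over.
  rewrite exchange_big; apply: eq_bigr => i _; rewrite mxE.
  rewrite [in RHS](sF (a ** bvec i) (memvf _)) /bcoord linear_sum.
  by apply: eq_bigr => f _ /=; rewrite linearZ /= (formZ psi_ipL) mulrC.
have tr_ge0 : 0 <= \tr (lmx a) by rewrite -trE; apply: sumr_ge0.
apply: (le_trans _ (lmx_trace_le a)); rewrite ger0_norm // -trE psiE.
by rewrite (big_rem cone) //= -[leLHS]addr0 lerD // sumr_ge0.
Qed.

(* Enough to be positive for the left regular representation. *)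
Lemma positive_psi (x : B) :
  star x = x -> (forall y, 0 <= psi_ip y (x ** y)) -> positive x.
Proof.
move=> xs x_ge0; split=> // k; apply: contra_notP => kn0.
have conj_ge0 (l : K) : 0 <= l -> 0 <= l^*.
  by move=> l0; rewrite (CrealP (ger0_real l0)).
have eig (l : K) y : x ** y = l *: y -> ~ 0 <= l -> y = 0.
  move=> xy ln0; apply: contra_notP ln0 => /eqP yn0.
  have y0 : 0 < psi_ip y y.
    rewrite lt_neqAle psi_ip_ge0 andbT eq_sym; apply: contra_neq yn0.
    exact: psi_ip_def.
  by have := x_ge0 y; rewrite xy (formZ psi_ipL) pmulr_lge0.
have rinv (l : K) : ~ 0 <= l -> exists z, (x - l *: cone) ** z = cone.
  move=> ln0; pose L (y : B) := (x - l *: cone) ** y.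
  have LL : linear L by exact: cmul_linr.
  pose L' : {linear B -> B} := HB.pack L (GRing.isLinear.Build _ _ _ _ L LL).
  have ker : lker (linfun L') == 0%VS.
    apply/lker0P => y1 y2; rewrite !lfunE /= => e.
    apply/eqP; rewrite -subr_eq0; apply/eqP; apply: (eig l) => //.
    have : L (y1 - y2) = 0.
      by rewrite -[y1 - y2]addrC -scaleN1r LL e scaleN1r addNr.
    rewrite /L cmulDl -scaleNr cmulZl cmul1x scaleNr => /eqP.
    by rewrite subr_eq0 => /eqP.
  have : (cone : B) \in limg (linfun L').
    rewrite (_ : limg _ = fullv) ?memvf //; apply/eqP.
    rewrite eqEdim subvf /= limg_dim_eq //.
    by rewrite (eqP ker) capv0.
  by move/memv_imgP => [z _ zE]; exists z; rewrite {2}zE lfunE.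
have [z zE] := rinv k kn0.
have kn0' : ~ 0 <= k^*.
  by move=> h; apply: kn0; rewrite -[k]conjCK; exact: conj_ge0.
have [z' z'E] := rinv _ kn0'.
exists z; split=> //.
have z''E : star z' ** (x - k *: cone) = cone.
  apply: etrans (etrans (congr1 star z'E) (star_cone _)).
  rewrite starM; congr (_ ** _).
  by rewrite starD -!scaleNr starZ rmorphN /= conjCK xs star_cone.
suff -> : z = star z' by [].
have := cmulA (star z') (x - k *: cone) z.
by rewrite zE z''E cmulx1 cmul1x.
Qed.

Lemma tens_linl (b : B) : linear (fun a : B => tens a b).
Proof.
move=> k a a'; apply/matrixP => i j; rewrite !mxE bcoord_lin.
by rewrite mulrDl mulrA.
Qed.
Lemma tens_linr (a : B) : linear (tens a).
Proof.
move=> k b b'; apply/matrixP => i j; rewrite !mxE bcoord_lin.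
by rewrite mulrDr mulrCA.
Qed.

Lemma tens_bvec i j : tens (bvec i) (bvec j : B) = delta_mx i j.
Proof.
apply/matrixP => k l; rewrite !mxE !bcoord_bvec -natrM mulnb.
by rewrite ![_ == k]eq_sym ![_ == l]eq_sym.
Qed.

Lemma tensor_ind (P : tensor B -> Prop) : P 0 ->
  (forall T S, P T -> P S -> P (T + S)) -> (forall a b, P (tens a b)) ->
  forall T, P T.
Proof.
move=> P0 PD Pt T; rewrite [T]matrix_sum_delta.
apply: (big_ind P) => // i _; apply: (big_ind P) => // j _.
rewrite -tens_bvec (_ : _ *: _ = tens (T i j *: bvec i) (bvec j)) //.
by apply/matrixP => k l; rewrite !mxE /bcoord linearZ /= mulrA.
Qed.

Lemma tlift_lin (V : lmodType K) (f : B -> B -> V) : linear (tlift f).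
Proof.
move=> k T S; rewrite /tlift scaler_sumr -big_split; apply: eq_bigr => i _ /=.
rewrite scaler_sumr -big_split; apply: eq_bigr => j _ /=.
by rewrite !mxE scalerDl scalerA.
Qed.

Lemma tlift_tens (V : lmodType K) (f : B -> B -> V) a b :
  (forall y, linear (f^~ y)) -> (forall x, linear (f x)) ->
  tlift f (tens a b) = f a b.
Proof.
move=> fl fr; rewrite {2}[a]bvec_span (lin_comb _ _ _ (fl b)).
apply: eq_bigr => i _; rewrite {2}[b]bvec_span (lin_comb _ _ _ (fr _)).
by rewrite scaler_sumr; apply: eq_bigr => j _; rewrite mxE scalerA.
Qed.

Lemma tlift2_lin (V : lmodType K) (h : B -> B -> B -> B -> V) T :
  linear (tlift2 h T).
Proof.
move=> k S S'; rewrite /tlift2.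
do 4 (rewrite scaler_sumr -big_split; apply: eq_bigr => ? _ /=).
by rewrite !mxE scalerA -scalerDl; congr (_ *: _); ring.
Qed.

Lemma tlift2_add (V : lmodType K) (h : B -> B -> B -> B -> V) S T T' :
  tlift2 h (T + T') S = tlift2 h T S + tlift2 h T' S.
Proof.
rewrite /tlift2.
do 4 (rewrite -big_split; apply: eq_bigr => ? _ /=).
by rewrite !mxE -scalerDl rmorphD mulrDl.
Qed.

Lemma tlift2_tens (V : lmodType K) (h : B -> B -> B -> B -> V) a b c d :
  (forall b c d k a a', h (k *: a + a') b c d = k^* *: h a b c d + h a' b c d) ->
  (forall a c d k b b', h a (k *: b + b') c d = k^* *: h a b c d + h a b' c d) ->
  (forall a b d, linear (fun c => h a b c d)) ->
  (forall a b c, linear (h a b c)) ->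
  tlift2 h (tens a b) (tens c d) = h a b c d.
Proof.
move=> h1 h2 h3 h4.
rewrite {2}[a]bvec_span (clin_comb _ _ _ (h1 b c d)); apply: eq_bigr => i _.
rewrite {2}[b]bvec_span (clin_comb _ _ _ (h2 (bvec i) c d)) scaler_sumr.
apply: eq_bigr => j _.
rewrite {2}[c]bvec_span (lin_comb _ _ _ (h3 (bvec i) (bvec j) d)) !scaler_sumr.
apply: eq_bigr => k _.
rewrite {2}[d]bvec_span (lin_comb _ _ _ (h4 (bvec i) (bvec j) (bvec k))) !scaler_sumr.
apply: eq_bigr => l _.
by rewrite !scalerA !mxE rmorphM; congr (_ *: _); ring.
Qed.

Lemma tmul_tens (a b : B) : tmul (tens a b) = a ** b.
Proof. by rewrite /tmul tlift_tens //; [exact: cmul_linl|exact: cmul_linr]. Qed.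

Lemma tmap_tens (f g : B -> B) a b :
  linear f -> linear g -> tmap f g (tens a b) = tens (f a) (g b).
Proof.
move=> fL gL; rewrite /tmap tlift_tens //.
  by move=> y k x x'; rewrite fL tens_linl.
by move=> x k y y'; rewrite gL tens_linr.
Qed.

Lemma id_lin : linear (@id B). Proof. by []. Qed.

Lemma tlact_tens x a b : tlact x (tens a b) = tens (x ** a) b :> tensor B.
Proof. by rewrite /tlact tmap_tens //; exact: cmul_linr. Qed.
Lemma tract_tens y a b : tract (tens a b) y = tens a (b ** y) :> tensor B.
Proof. by rewrite /tract tmap_tens //; exact: cmul_linl. Qed.

Lemma tip_tens a b c d :
  tip psi (tens a b) (tens c d) = psi (star a ** c) *: (star b ** d).
Proof.
rewrite /tip tlift2_tens // => *.
- by rewrite starD starZ cmulDl cmulZl linearP scalerDl scalerA.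
- by rewrite starD starZ cmulDl cmulZl scalerDr !scalerA mulrC.
- by move=> k x y; rewrite cmulDr cmulZr linearP scalerDl scalerA.
- by move=> k x y; rewrite cmulDr cmulZr scalerDr !scalerA mulrC.
Qed.

Lemma ip_psi2_tens a b c d :
  ip_psi2 psi (tens a b) (tens c d) = psi (star a ** c) * psi (star b ** d).
Proof.
rewrite /ip_psi2 tlift2_tens // => *.
- by rewrite starD starZ cmulDl cmulZl linearP mulrDl -mulrA.
- by rewrite starD starZ cmulDl cmulZl linearP mulrDr mulrCA.
- by move=> k x y; rewrite cmulDr cmulZr linearP mulrDl -mulrA.
- by move=> k x y; rewrite cmulDr cmulZr linearP mulrDr mulrCA.
Qed.

Lemma starN (A : cstarAlgType R) (x : A) : star (- x) = - star x.
Proof. by rewrite -scaleN1r starZ rmorphN1 scaleN1r. Qed.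
Lemma star0 (A : cstarAlgType R) : star (0 : A) = 0.
Proof. by rewrite -(scale0r (0 : A)) starZ rmorph0 !scale0r. Qed.

Lemma psi_star x : psi (star x) = (psi x)^*.
Proof.
by have := psi_ipC x cone; rewrite /psi_ip star_cone cmul1x cmulx1.
Qed.

Lemma lin_add (U V : lmodType K) (f : U -> V) x y : linear f -> f (x + y) = f x + f y.
Proof. by move=> fL; have := fL 1 x y; rewrite !scale1r. Qed.
Lemma lin_0 (U V : lmodType K) (f : U -> V) : linear f -> f 0 = 0.
Proof. by move=> fL; have := fL (-1) 0 0; rewrite scaler0 addr0 scaleN1r addNr. Qed.

Lemma tipl0 S : tip psi 0 S = 0.
Proof.
have := tlift2_add (fun a b c d : B => psi (star a ** c) *: (star b ** d)) S 0 0.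
by rewrite addr0 -[X in X = _]addr0 => /addrI /esym.
Qed.
Lemma tiplD T T' S : tip psi (T + T') S = tip psi T S + tip psi T' S.
Proof. exact: tlift2_add. Qed.
Lemma tip_lin T : linear (tip psi T).
Proof. exact: tlift2_lin. Qed.

Lemma tlact_linr x : linear (@tlact R B x).
Proof. exact: tlift_lin. Qed.
Lemma tract_linl y : linear ((@tract R B)^~ y).
Proof. exact: tlift_lin. Qed.

Lemma tlact_linl T : linear ((@tlact R B)^~ T).
Proof.
move=> k x y; elim/tensor_ind: T => [|T S hT hS|a b].
- by rewrite !(lin_0 (tlact_linr _)) scaler0 addr0.
- by rewrite !(lin_add _ _ (tlact_linr _)) hT hS scalerDr addrACA.
- by rewrite !tlact_tens cmul_linl tens_linl.
Qed.
Lemma tract_linr T : linear (@tract R B T).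
Proof.
move=> k x y; elim/tensor_ind: T => [|T S hT hS|a b].
- by rewrite !(lin_0 (tract_linl _)) scaler0 addr0.
- by rewrite !(lin_add _ _ (tract_linl _)) hT hS scalerDr addrACA.
- by rewrite !tract_tens cmul_linr tens_linr.
Qed.
Lemma tlactM x y (T : tensor B) : tlact (x ** y) T = tlact x (tlact y T).
Proof.
elim/tensor_ind: T => [|T S hT hS|a b].
- by rewrite !(lin_0 (tlact_linr _)).
- by rewrite !(lin_add _ _ (tlact_linr _)) hT hS.
- by rewrite !tlact_tens cmulA.
Qed.
Lemma tractM x y (T : tensor B) : tract T (x ** y) = tract (tract T x) y.
Proof.
elim/tensor_ind: T => [|T S hT hS|a b].
- by rewrite !(lin_0 (tract_linl _)).
- by rewrite !(lin_add _ _ (tract_linl _)) hT hS.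
- by rewrite !tract_tens cmulA.
Qed.
Lemma tract1 (T : tensor B) : tract T cone = T.
Proof.
elim/tensor_ind: T => [|T S hT hS|a b].
- by rewrite !(lin_0 (tract_linl _)).
- by rewrite !(lin_add _ _ (tract_linl _)) hT hS.
- by rewrite !tract_tens cmulx1.
Qed.
Lemma tlact1 (T : tensor B) : tlact cone T = T.
Proof.
elim/tensor_ind: T => [|T S hT hS|a b].
- by rewrite !(lin_0 (tlact_linr _)).
- by rewrite !(lin_add _ _ (tlact_linr _)) hT hS.
- by rewrite !tlact_tens cmul1x.
Qed.
Lemma tlactract x y (T : tensor B) : tlact x (tract T y) = tract (tlact x T) y.
Proof.
elim/tensor_ind: T => [|T S hT hS|a b].
- by rewrite ?(lin_0 (tract_linl _)) ?(lin_0 (tlact_linr _)) ?(lin_0 (tract_linl _)).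
- by rewrite !(lin_add _ _ (tract_linl _)) !(lin_add _ _ (tlact_linr _))
     !(lin_add _ _ (tract_linl _)) hT hS.
- by rewrite !tlact_tens !tract_tens tlact_tens.
Qed.

Lemma tip_star T S : star (tip psi T S) = tip psi S T.
Proof.
elim/tensor_ind: T => [|T T' hT hT'|a b].
- by rewrite tipl0 (lin_0 (tip_lin _)) star0.
- by rewrite tiplD starD hT hT' (lin_add _ _ (tip_lin _)).
elim/tensor_ind: S => [|S S' hS hS'|c d].
- by rewrite tipl0 (lin_0 (tip_lin _)) star0.
- by rewrite tiplD (lin_add _ _ (tip_lin _)) starD hS hS'.
by rewrite !tip_tens starZ -psi_star !starM !starK.
Qed.

Lemma tip_tract T S y : tip psi T (tract S y) = tip psi T S ** y.
Proof.
elim/tensor_ind: T => [|T T' hT hT'|a b].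
- by rewrite !tipl0 cmul0x.
- by rewrite !tiplD hT hT' cmulDl.
elim/tensor_ind: S => [|S S' hS hS'|c d].
- by rewrite (lin_0 (tract_linl _)) (lin_0 (tip_lin _)) cmul0x.
- by rewrite (lin_add _ _ (tract_linl _)) !(lin_add _ _ (tip_lin _)) hS hS' cmulDl.
by rewrite tract_tens !tip_tens cmulZl cmulA.
Qed.

Lemma tip_tlact x T S : tip psi (tlact x T) S = tip psi T (tlact (star x) S).
Proof.
elim/tensor_ind: T => [|T T' hT hT'|a b].
- by rewrite (lin_0 (tlact_linr _)) !tipl0.
- by rewrite (lin_add _ _ (tlact_linr _)) !tiplD hT hT'.
elim/tensor_ind: S => [|S S' hS hS'|c d].
- by rewrite (lin_0 (tlact_linr _)) !(lin_0 (tip_lin _)).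
- by rewrite (lin_add _ _ (tlact_linr _)) !(lin_add _ _ (tip_lin _)) hS hS'.
by rewrite !tlact_tens !tip_tens starM cmulA.
Qed.

Definition slice (f : B) : tensor B -> B := tlift (fun a b => psi_ip f a *: b).

Lemma slice_lin f : linear (slice f).
Proof. exact: tlift_lin. Qed.

Lemma slice_tens f a b : slice f (tens a b) = psi_ip f a *: b.
Proof.
rewrite /slice tlift_tens //.
  by move=> y k x x'; rewrite psi_ipL scalerDl scalerA.
by move=> x k y y'; rewrite scalerDr !scalerA mulrC.
Qed.

Lemma big_add (V : zmodType) (I : Type) (r : seq I) (F G : I -> V) :
  \sum_(i <- r) (F i + G i) = \sum_(i <- r) F i + \sum_(i <- r) G i.
Proof. exact: big_split. Qed.

Lemma tip_slice s T S : frame psi_ip fullv s ->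
  tip psi T S = \sum_(f <- s) star (slice f T) ** slice f S.
Proof.
move=> sF; elim/tensor_ind: T => [|T T' hT hT'|a b].
- by rewrite tipl0 big1 // => f _; rewrite (lin_0 (slice_lin _)) star0 cmul0x.
- rewrite tiplD hT hT' -big_add; apply: eq_bigr => f _.
  by rewrite (lin_add _ _ (slice_lin _)) starD cmulDl.
elim/tensor_ind: S => [|S S' hS hS'|c d].
- by rewrite (lin_0 (tip_lin _)) big1 // => f _; rewrite (lin_0 (slice_lin _)) cmulx0.
- rewrite (lin_add _ _ (tip_lin _)) hS hS' -big_add; apply: eq_bigr => f _.
  by rewrite (lin_add _ _ (slice_lin _)) cmulDr.
rewrite tip_tens -/(psi_ip _ _) (frame_parseval psi_ipL psi_ipC a sF (memvf c)).
rewrite scaler_suml; apply: eq_bigr => f _.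
by rewrite !slice_tens starZ cmulZl cmulZr scalerA.
Qed.

Lemma tensor_slice s T : frame psi_ip fullv s ->
  T = \sum_(f <- s) tens f (slice f T).
Proof.
move=> sF; elim/tensor_ind: T => [|T T' hT hT'|a b].
- by rewrite big1 // => f _; rewrite (lin_0 (slice_lin _)) (lin_0 (tens_linr _)).
- rewrite {1}hT {1}hT' -big_add; apply: eq_bigr => f _.
  by rewrite (lin_add _ _ (slice_lin _)) (lin_add _ _ (tens_linr _)).
rewrite {1}(sF.2 a (memvf a)) (lin_comb _ _ _ (tens_linl b)).
apply: eq_bigr => f _; rewrite slice_tens.
have := tens_linr f (psi_ip f a) b 0.
by rewrite (lin_0 (tens_linr _)) !addr0.
Qed.

Lemma tip_psi_ge0 T y : 0 <= psi_ip y (tip psi T T ** y).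
Proof.
have [s sF] := frame_full psi_ipL psi_ipC psi_ip_ge0 psi_ip_def.
rewrite (tip_slice T T sF) (big_morph (fun x : B => x ** y) (fun a b => cmulDl a b y) (cmul0x y)).
rewrite (form_sum psi_ipL); apply: sumr_ge0 => f _.
rewrite (_ : psi_ip _ _ = psi_ip (slice f T ** y) (slice f T ** y)) ?psi_ip_ge0 //.
by rewrite /psi_ip starM !cmulA.
Qed.

Lemma tip_pos T : positive (tip psi T T).
Proof. by apply: positive_psi => [|y]; [exact: tip_star|exact: tip_psi_ge0]. Qed.

Lemma psi_tip_ge0 T : 0 <= psi (tip psi T T).
Proof.
by have := tip_psi_ge0 T cone; rewrite /psi_ip star_cone cmul1x cmulx1.
Qed.

Lemma psi_tip_def T : psi (tip psi T T) = 0 -> T = 0.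
Proof.
have [s sF] := frame_full psi_ipL psi_ipC psi_ip_ge0 psi_ip_def.
rewrite (tip_slice T T sF) linear_sum => /eqP.
rewrite psumr_eq0 => [|f _]; last exact: fqs_psi_ge0.
move=> /allP h; rewrite (tensor_slice T sF) big_seq big1 // => f fs.
by rewrite (fqs_faithful (eqP (h f fs))) (lin_0 (tens_linr _)).
Qed.

Lemma psi_tip_le T : psi (tip psi T T) <= `|tip psi T T| *+ \dim {:B}.
Proof. by apply: psi_le => y; exact: tip_psi_ge0. Qed.

End QuantumSpace.

Lemma complex_complete (R : realType) (u : nat -> R[i]) :
  (forall e : R[i], 0 < e -> exists N, forall m n, (N <= m)%N -> (N <= n)%N ->
     `|u m - u n| < e) ->
  exists l, forall e : R[i], 0 < e -> exists N, forall n, (N <= n)%N ->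
     `|u n - l| < e.
Proof.
move=> uC.
have real_case (p : R[i] -> R) : (forall x y, p (x - y) = p x - p y) ->
    (forall x, `|p x|%:C%C <= `|x|) ->
    exists l : R, forall e : R, 0 < e -> exists N, forall n, (N <= n)%N ->
      `|p (u n) - l| < e.
  move=> pB ple.
  have : cvg (p (u n) @[n --> \oo]).
    apply/cauchy_cvgP/cauchy_exP => e e0.
    have ec : 0 < e%:C%C by rewrite ltcR.
    have [N hN] := uC _ ec; exists (p (u N)); exists N => // n /= Nn.
    by rewrite /ball /= -pB -ltcR; apply: (le_lt_trans (ple _)); exact: hN.
  move=> /cvg_ex[l hl]; exists l => e e0.
  have /cvgrPdist_lt/(_ e e0)[N _ hN] := hl.
  by exists N => n Nn; rewrite distrC; exact: hN.
have ReB : forall x y : R[i], complex.Re (x - y) = complex.Re x - complex.Re y.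
  by case=> a b [c d].
have ImB : forall x y : R[i], complex.Im (x - y) = complex.Im x - complex.Im y.
  by case=> a b [c d].
have Rele : forall x : R[i], `|complex.Re x|%:C%C <= `|x|.
  move=> x; rewrite normc_def lecR -sqrtr_sqr ler_wsqrtr //.
  by rewrite lerDl sqr_ge0.
have Imle : forall x : R[i], `|complex.Im x|%:C%C <= `|x|.
  move=> x; rewrite normc_def lecR -sqrtr_sqr ler_wsqrtr //.
  by rewrite lerDr sqr_ge0.
have [a ha] := real_case _ ReB Rele; have [b hb] := real_case _ ImB Imle.
exists (Complex a b) => e e0.
have [er eE] : exists er : R, e = er%:C%C.
  by apply/complex_realP; exact: gtr0_real.
rewrite eE in e0 *; rewrite ltcR in e0.
have [N1 h1] := ha (er / 2) (divr_gt0 e0 (ltr0n _ 2)).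
have [N2 h2] := hb (er / 2) (divr_gt0 e0 (ltr0n _ 2)).
exists (maxn N1 N2) => n; rewrite geq_max => /andP[/h1 {}h1 /h2 {}h2].
have triangle (x : R[i]) : `|x| <= (`|complex.Re x| + `|complex.Im x|)%:C%C.
  rewrite normc_def lecR -[leRHS]ger0_norm ?addr_ge0 // -sqrtr_sqr ler_wsqrtr //.
  rewrite sqrrD -!normrX !(ger0_norm (sqr_ge0 _)) addrAC lerDl.
  by rewrite mulrn_wge0 // mulr_ge0.
apply: (le_lt_trans (triangle _)); rewrite ltcR ReB ImB /=.
by rewrite [ltRHS](splitr er) ltrD.
Qed.

(* A finite-dimensional pre-Hilbert module is complete, provided its B-valued
   form ip is dominated from below by a scalar inner product. *)
Section FiniteDimensionalComplete.
Variables (R : realType) (B : cstarAlgType R) (V : vectType R[i]).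
Variables (ipV : V -> V -> B) (h : V -> V -> R[i]) (C : nat).
Hypothesis hL : forall x, scalar (h x).
Hypothesis hC : forall x y, h x y = (h y x)^*.
Hypothesis h_ge0 : forall x, 0 <= h x x.
Hypothesis h_def : forall x, h x x = 0 -> x = 0.
Hypothesis ipL : forall x, linear (ipV x).
Hypothesis ipC : forall x y, star (ipV x y) = ipV y x.
Hypothesis h_le : forall x, h x x <= `|ipV x x| *+ C.

Lemma fd_complete (u : nat -> V) :
  (forall e : R[i], 0 < e -> exists N, forall m n, (N <= m)%N -> (N <= n)%N ->
     hnorm ipV (u m - u n) < e) ->
  exists l, forall e : R[i], 0 < e -> exists N, forall n, (N <= n)%N ->
     hnorm ipV (u n - l) < e.
Proof.
move=> uC; have [s sF] := frame_full hL hC h_ge0 h_def.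
have hnorm_ge0 x : 0 <= hnorm ipV x by rewrite sqrtC_ge0.
have hB f x y : h f (x - y) = h f x - h f y.
  by rewrite (formD hL) -scaleN1r (formZ hL) mulN1r.
have coordC f : f \in s -> exists l : R[i], forall e : R[i], 0 < e ->
    exists N, forall n, (N <= n)%N -> `|h f (u n) - l| < e.
  move=> fs; apply: complex_complete => e e0.
  have C0 : 0 < (C.+1%:R : R[i]) by rewrite ltr0n.
  have [N hN] := uC (e / C.+1%:R) (divr_gt0 e0 C0).
  exists N => m n Nm Nn; have {}hN := hN m n Nm Nn.
  rewrite -hB -(ltr_pXn2r (n := 2)) ?nnegrE ?(ltW e0) //.
  apply: (le_lt_trans (form_coord_le hL hC sF fs (memvf _))).
  apply: (le_lt_trans (h_le _)).
  have -> : `|ipV (u m - u n) (u m - u n)| = hnorm ipV (u m - u n) ^+ 2.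
    by rewrite sqrtCK.
  rewrite -mulr_natr; apply: (@le_lt_trans _ _ (hnorm ipV (u m - u n) ^+ 2 * C.+1%:R ^+ 2)).
    rewrite ler_wpM2l ?exprn_ge0 // -natrX ler_nat.
    by rewrite (leq_trans (leqnSn C)) // leq_pmulr.
  by rewrite -exprMn ltr_pXn2r ?nnegrE ?mulr_ge0 ?(ltW e0) ?(ltW C0) // -ltr_pdivlMr.
pose l f : R[i] := if pselect (f \in s) is left fs then projT1 (cid (coordC f fs)) else 0.
have lP f : f \in s -> forall e : R[i], 0 < e ->
    exists N, forall n, (N <= n)%N -> `|h f (u n) - l f| < e.
  by move=> fs; rewrite /l; case: pselect => // fs'; exact: (projT2 (cid (coordC f fs'))).
pose M := \sum_(f <- s) \sum_(g <- s) `|ipV f g|.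
have M_ge0 : 0 <= M by apply: sumr_ge0 => f _; apply: sumr_ge0.
exists (\sum_(f <- s) l f *: f) => e e0.
pose d := e / (M + 1).
have M1 : 0 < M + 1 by rewrite ltr_wpDl.
have d0 : 0 < d by rewrite divr_gt0.
have [N hN] : exists N, forall n, (N <= n)%N ->
    forall f, f \in s -> `|h f (u n) - l f| < d.
  elim: (s) (lP) => [|f r IH] rP; first by exists 0%N.
  have [N1 h1] := IH (fun g gr => rP g (mem_behead (s := f :: r) gr)).
  have [N2 h2] := rP f (mem_head f r) d d0.
  exists (maxn N1 N2) => n; rewrite geq_max => /andP[n1 n2] g.
  by rewrite inE => /orP[/eqP ->|gr]; [exact: h2|exact: h1].
exists N => n Nn; pose c f := h f (u n) - l f.
have -> : u n - \sum_(f <- s) l f *: f = \sum_(f <- s) c f *: f.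
  rewrite {1}(sF.2 (u n) (memvf _)) -sumrB; apply: eq_bigr => f _.
  by rewrite scalerBl.
have cd f : f \in s -> `|c f| <= d by move=> fs; apply: ltW; exact: hN.
have ipS x : ipV (\sum_(f <- s) c f *: f) x = \sum_(f <- s) (c f)^* *: ipV f x.
  rewrite -ipC (lin_comb _ _ _ (ipL x)).
  have starL (k : R[i]) (a b : B) : star (k *: a + b) = k^* *: star a + star b.
    by rewrite starD starZ.
  by rewrite (clin_comb _ _ _ starL); apply: eq_bigr => f _; rewrite ipC.
have le2 : `|ipV (\sum_(f <- s) c f *: f) (\sum_(f <- s) c f *: f)| <= d ^+ 2 * M.
  rewrite ipS mulr_sumr; apply: (le_trans (ler_norm_sum _ _ _)).
  rewrite big_seq [leRHS]big_seq; apply: ler_sum => f fs.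
  rewrite (lin_comb _ _ _ (ipL f)) normrZ mulr_sumr norm_conjC.
  apply: (@le_trans _ _ (d * \sum_(g <- s) d * `|ipV f g|)).
    apply: ler_pM => //; first exact: cd.
    apply: (le_trans (ler_norm_sum _ _ _)).
    rewrite big_seq [leRHS]big_seq; apply: ler_sum => g gs.
    by rewrite normrZ ler_wpM2r // cd.
  by rewrite mulr_sumr; apply: ler_sum => g _; rewrite mulrA expr2.
rewrite -(ltr_pXn2r (n := 2)) ?nnegrE ?(ltW e0) // sqrtCK.
apply: (le_lt_trans le2).
have eE : e = d * (M + 1) by rewrite divfK // gt_eqF.
rewrite eE [ltRHS]exprMn ltr_pM2l ?exprn_gt0 //.
apply: (@lt_le_trans _ _ (M + 1)); first by rewrite ltrDl.
by rewrite expr2 ler_peMr ?(ltW M1) // lerDr.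
Qed.

End FiniteDimensionalComplete.

Section EdgeCorrespondence.
Variables (R : realType) (B : fdCStarAlgType R) (G : quantum_graph B).
Local Notation psi := (fqs_psi G).

Definition edge_vector : tensor B :=
  ((fqs_delta G ^+ 2)^-1)%:C%C *: tmap id (qg_adj G) (fqs_mstar G cone).

Definition edge_space : {vspace tensor B} :=
  <<[seq tract (tlact x edge_vector) y | x <- vbasis {:B}, y <- vbasis {:B}]>>%VS.

Lemma mem_edge_gen x y : tract (tlact x edge_vector) y \in edge_space.
Proof.
rewrite [x]bvec_span [y]bvec_span (lin_comb _ _ _ (tract_linr _)).
apply: memv_suml => j _; apply: memvZ.
rewrite (lin_comb _ _ _ (tlact_linl edge_vector)).
rewrite (lin_comb _ _ _ (tract_linl _)).
apply: memv_suml => i _; apply: memvZ; apply: memv_span.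
by apply: allpairs_f; rewrite mem_nth // size_tuple.
Qed.

(* edge_space is the span of all the x . edge_vector . y. *)
Lemma mem_edge_space (T : tensor B) : T \in edge_space <->
  exists s : seq (B * B), T = \sum_(p <- s) tract (tlact p.1 edge_vector) p.2.
Proof.
split; last first.
  by case=> s ->; apply: memv_suml => p _; exact: mem_edge_gen.
pose X := [seq tract (tlact x edge_vector) y | x <- vbasis {:B}, y <- vbasis {:B}].
move=> /(@coord_span _ _ _ (in_tuple X)) ->.
have : forall i : 'I_(size X), exists p : B * B, X`_i = tract (tlact p.1 edge_vector) p.2.
  move=> i; have /allpairsP[p [_ _ ->]] : X`_i \in X by exact: mem_nth.
  by exists p.
move=> /choice[p pE].
exists [seq (coord (in_tuple X) i T *: (p i).1, (p i).2) | i <- index_enum 'I_(size X)].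
rewrite big_map; apply: eq_bigr => i _ /=; rewrite pE.
have := tlact_linl edge_vector (coord (in_tuple X) i T) (p i).1 0.
rewrite (lin_0 (tlact_linl edge_vector)) !addr0 => ->.
by have := tract_linl (p i).2 (coord (in_tuple X) i T) (tlact (p i).1 edge_vector) 0;
   rewrite (lin_0 (tract_linl _)) !addr0.
Qed.

Lemma edge_tlact x T : T \in edge_space -> tlact x T \in edge_space.
Proof.
move=> /mem_edge_space[s ->].
rewrite (big_morph (tlact x) (fun a b => lin_add a b (tlact_linr x)) (lin_0 (tlact_linr x))).
apply: memv_suml => p _; rewrite tlactract -tlactM; exact: mem_edge_gen.
Qed.
Lemma edge_tract y T : T \in edge_space -> tract T y \in edge_space.
Proof.
move=> /mem_edge_space[s ->].
rewrite (big_morph ((@tract R B)^~ y) (fun a b => lin_add a b (tract_linl y)) (lin_0 (tract_linl y))).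
apply: memv_suml => p _; rewrite -tractM; exact: mem_edge_gen.
Qed.

Definition edge_sort := subvs_of edge_space.
HB.instance Definition _ := Vector.on edge_sort.

Definition edge_lact (x : B) (xi : edge_sort) : edge_sort :=
  Subvs (edge_tlact x (subvsP xi)).
Definition edge_ract (xi : edge_sort) (y : B) : edge_sort :=
  Subvs (edge_tract y (subvsP xi)).
Definition edge_ip (xi eta : edge_sort) : B := tip psi (vsval xi) (vsval eta).

Fact edge_ract_linearl b : linear (edge_ract^~ b).
Proof. by move=> k xi eta; apply: val_inj => /=; rewrite tract_linl. Qed.
Fact edge_ract_linearr xi : linear (edge_ract xi).
Proof. by move=> k b c; apply: val_inj => /=; rewrite tract_linr. Qed.
Fact edge_ractM xi b c : edge_ract xi (b ** c) = edge_ract (edge_ract xi b) c.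
Proof. by apply: val_inj; exact: tractM. Qed.
Fact edge_ract1 xi : edge_ract xi cone = xi.
Proof. by apply: val_inj; exact: tract1. Qed.
Fact edge_ip_linear xi : linear (edge_ip xi).
Proof. by move=> k a b; rewrite /edge_ip linearP tip_lin. Qed.
Fact edge_ip_ract xi eta b : edge_ip xi (edge_ract eta b) = edge_ip xi eta ** b.
Proof. exact: tip_tract. Qed.
Fact edge_ip_star xi eta : star (edge_ip xi eta) = edge_ip eta xi.
Proof. exact: tip_star. Qed.
Fact edge_ip_positive xi : positive (edge_ip xi xi).
Proof. exact: tip_pos. Qed.
Fact edge_ip_definite xi : edge_ip xi xi = 0 -> xi = 0.
Proof.
move=> h; apply: val_inj; apply: (@psi_tip_def _ _ (qg_space G)).
by rewrite -/(edge_ip xi xi) h linear0.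
Qed.
Fact edge_lact_linearl xi : linear (edge_lact^~ xi).
Proof. by move=> k x y; apply: val_inj => /=; rewrite tlact_linl. Qed.
Fact edge_lact_linearr x : linear (edge_lact x).
Proof. by move=> k xi eta; apply: val_inj => /=; rewrite tlact_linr. Qed.
Fact edge_lactM x y xi : edge_lact (x ** y) xi = edge_lact x (edge_lact y xi).
Proof. by apply: val_inj; exact: tlactM. Qed.
Fact edge_lact_adj x xi eta :
  edge_ip (edge_lact x xi) eta = edge_ip xi (edge_lact (star x) eta).
Proof. exact: tip_tlact. Qed.

Fact edge_complete (u : nat -> edge_sort) :
  (forall e : R[i], 0 < e -> exists N, forall m n, (N <= m)%N -> (N <= n)%N ->
     hnorm edge_ip (u m - u n) < e) ->
  exists l, forall e : R[i], 0 < e -> exists N, forall n, (N <= n)%N ->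
     hnorm edge_ip (u n - l) < e.
Proof.
apply: (@fd_complete _ _ _ _ (fun xi eta => psi (edge_ip xi eta)) (\dim {:B})).
- by move=> xi k a b; rewrite edge_ip_linear linearP.
- by move=> xi eta; rewrite -(psi_star G) edge_ip_star.
- by move=> xi; exact: psi_tip_ge0.
- by move=> xi h; apply: val_inj; exact: (@psi_tip_def _ _ (qg_space G)).
- exact: edge_ip_linear.
- exact: edge_ip_star.
- by move=> xi; exact: psi_tip_le.
Qed.

Definition edge_correspondence : correspondence B :=
  Correspondence edge_ract_linearl edge_ract_linearr edge_ractM edge_ract1
    edge_ip_linear edge_ip_ract edge_ip_star edge_ip_positive edge_ip_definite
    edge_complete edge_lact_linearl edge_lact_linearr edge_lactM edge_lact_adj.

End EdgeCorrespondence.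

Section GraphOfHom.
Variables (R : realType) (B : fdCStarAlgType R) (Q : finite_quantum_space B).
Variables (alpha : B -> B) (alpha_hom : star_hom alpha).

Let alpha_linear : linear alpha. Proof. by case: alpha_hom. Qed.
Let alphaM : {morph alpha : x y / x ** y}. Proof. by case: alpha_hom. Qed.

Definition star_hom_linear : {linear B -> B} :=
  HB.pack alpha (GRing.isLinear.Build _ _ _ _ alpha alpha_linear).

Fact hom_schur x : tmul (tmap star_hom_linear star_hom_linear (fqs_mstar Q x)) =
  (fqs_delta Q ^+ 2)%:C%C *: star_hom_linear x.
Proof.
rewrite -linearZ -fqs_delta_form /=.
have tmulL : linear (@tmul R B) by exact: tlift_lin.
have tmapL : linear (@tmap R B alpha alpha) by exact: tlift_lin.
elim/tensor_ind: (fqs_mstar Q x) => [|T S hT hS|a b].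
- by rewrite (lin_0 tmapL) (lin_0 tmulL) (lin_0 alpha_linear).
- by rewrite (lin_add _ _ tmapL) !(lin_add _ _ tmulL) hT hS (lin_add _ _ alpha_linear).
- by rewrite tmap_tens // !tmul_tens alphaM.
Qed.

Definition graph_of_hom : quantum_graph B := QuantumGraph hom_schur.

End GraphOfHom.

(* Main.v *)
(** The multiplication satisfies [<m^*(1), T>_B = m(T)], so the bimodule
   generator [delta *: edge_vector] of [E_alpha] is a unit vector [xi0] for
   the B-valued inner product and satisfies [x . xi0 = xi0 . alpha(x)]; hence
   [xi = xi0 . <xi0, xi>] for every [xi].  For a correspondence with such a
   vector the Katsura ideal is all of B, and covariant representations
   [(pi, t)] correspond to covariant pairs [(pi, v)] through
   [v = t(xi0)^*] and [t(xi) = v^* pi(<xi0, xi>)], so the two universal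
   properties coincide. *)
Require Import Defs.
From HB Require Import structures.
From mathcomp Require Import all_boot all_order all_algebra.
From mathcomp Require Import complex.
From mathcomp Require Import all_classical all_reals.
From mathcomp Require Import topology normedtype.

Set Implicit Arguments.
Unset Strict Implicit.
Unset Printing Implicit Defensive.
Import Order.TTheory GRing.Theory Num.Theory.
Import numFieldNormedType.Exports.
Local Open Scope classical_set_scope.
Local Open Scope ring_scope.
Local Open Scope cstar_scope.

(** * Closed conditions and local units in C*-algebras *)

Section CStarAlgebras.
Variable R : realType.
Implicit Types A D : cstarAlgType R.

Lemma cmul_subl A (x y z : A) : (x - y) ** z = x ** z - y ** z.
Proof. by rewrite cmulDl -scaleN1r cmulZl scaleN1r. Qed.

Lemma cmul_subr A (x y z : A) : x ** (y - z) = x ** y - x ** z.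
Proof. by rewrite cmulDr -scaleN1r cmulZr scaleN1r. Qed.

Lemma cmul_0l A (x : A) : 0 ** x = 0.
Proof. by rewrite -(scale0r (0 : A)) cmulZl !scale0r. Qed.

Lemma cmul_0r A (x : A) : x ** 0 = 0.
Proof. by rewrite -(scale0r (0 : A)) cmulZr !scale0r. Qed.

Lemma star_sub A (x y : A) : star (x - y) = star x - star y.
Proof. by rewrite starD starN. Qed.

Lemma cstar_eq0 A (x : A) : star x ** x = 0 -> x = 0.
Proof.
move=> h; have /esym/eqP := normCstar x.
by rewrite h normr0 expf_eq0 normr_eq0 => /eqP.
Qed.

Lemma star_hom_comp A D (E : cstarAlgType R) (f : A -> D) (g : D -> E) :
  star_hom f -> star_hom g -> star_hom (g \o f).
Proof.
move=> [fL fM fS] [gL gM gS]; split=> [k x y|x y|x] /=.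
- by rewrite fL gL.
- by rewrite fM gM.
- by rewrite fS gS.
Qed.

Lemma linear_scale (U V : lmodType R[i]) (f : U -> V) k x :
  linear f -> f (k *: x) = k *: f x.
Proof. by move=> fL; have := fL k x 0; rewrite (lin_0 fL) !addr0. Qed.

(** The difference [f - g] is additive and bounded, hence continuous: at a limit point [x] it takes
    the same value as at [x - y], for [y] in the set within [e / k] of [x]. *)
Lemma closed_bounded_eq A (f g : A -> A) (k : R[i]) : 0 < k ->
  {morph f : x y / x - y} -> {morph g : x y / x - y} ->
  (forall x, `|f x - g x| <= k * `|x|) -> closed [set x | f x = g x].
Proof.
move=> k0 fB gB fg x xcl; apply/eqP; rewrite -subr_eq0 -normr_eq0.
rewrite eq_le normr_ge0 andbT; apply/ler_addgt0Pl => e e0; rewrite addr0.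
have [y [/= fgy xy]] := xcl _ (nbhsx_ballx x (e / k) (divr_gt0 e0 k0)).
have -> : f x - g x = f (x - y) - g (x - y).
  by rewrite fB gB fgy opprB addrA subrK.
apply: (le_trans (fg _)); rewrite -ler_pdivlMl // mulrC.
by move: xy; rewrite -ball_normE /= => /ltW.
Qed.

Lemma closed_local_unit A (p : A) :
  closed [set x | p ** x = x /\ x ** p = x].
Proof.
(* The bound comes from |p x - x| <= |p| |x| + |x|, and is positive even for [p = 0]. *)
have k0 : 0 < `|p| + 1 by rewrite ltr_wpDl.
apply: closedI.
- apply: (closed_bounded_eq k0) => [x y|//|x]; first exact: cmul_subr.
  rewrite mulrDl mul1r; apply: (le_trans (ler_normB _ _)).
  by rewrite lerD2r normM_le.
- apply: (closed_bounded_eq k0) => [x y|//|x]; first exact: cmul_subl.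
  rewrite mulrDl mul1r; apply: (le_trans (ler_normB _ _)).
  by rewrite lerD2r mulrC normM_le.
Qed.

(** The elements fixed by [p] on both sides form a C*-subalgebra; [star] exchanges the two equations
    because [p] is self-adjoint. *)
Lemma cstar_gen_unit A (G : set A) (p : A) :
  star p = p -> (forall x, G x -> p ** x = x /\ x ** p = x) ->
  forall x, cstar_gen G x -> p ** x = x /\ x ** p = x.
Proof.
move=> ps Gp x /(_ [set y | p ** y = y /\ y ** p = y]); apply; split=> //.
split=> [||k y z [py yp] [pz zp]|y z [py yp] [pz zp]|y [py yp]] /=.
- exact: closed_local_unit.
- by rewrite cmul_0l cmul_0r.
- by rewrite cmulDr cmulDl cmulZr cmulZl py yp pz zp.
- by rewrite cmulA py -cmulA zp.
- by rewrite -ps -!starM py yp.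
Qed.

End CStarAlgebras.

(** Makes the universal property of the crossed product, which only speaks of unital targets,
    applicable to a C*-algebra merely known to have a two-sided unit. *)
Lemma unital_cstar_ind (R : realType) (P : forall A : cstarAlgType R, A -> Prop) :
  (forall A : unitalCStarAlgType R, P A cone) ->
  forall (A : cstarAlgType R) (p : A),
    (forall x, p ** x = x) -> (forall x, x ** p = x) -> P A p.
Proof.
(* Records have no definitional eta: [A] must be destructed for the structure
   rebuilt from its mixins to be convertible to it. *)
move=> PU A; destruct A as [T []]; set A := CStarAlgebra.Pack _ => p pl pr.
pose U : unitalCStarAlgType R := HB.pack (CStarAlgebra.sort A)
  (hasCUnit.Build R (CStarAlgebra.sort A) pl pr).
exact: (PU U).
Qed.

(** * Right linearity of adjointable operators and of representations *)

Section Correspondences.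
Variables (R : realType) (B : unitalCStarAlgType R) (X : correspondence B).

Lemma ip_subr (xi eta zeta : X) : ip xi (eta - zeta) = ip xi eta - ip xi zeta.
Proof.
by rewrite addrC -scaleN1r ip_linear scaleN1r addrC.
Qed.

Lemma ip_ractl (xi eta : X) b : ip (ract xi b) eta = star b ** ip xi eta.
Proof. by rewrite -ip_star ip_ract starM ip_star. Qed.

Lemma ip_ext (eta zeta : X) : (forall xi : X, ip xi eta = ip xi zeta) -> eta = zeta.
Proof.
move=> h; apply/eqP; rewrite -subr_eq0; apply/eqP/ip_definite.
by rewrite ip_subr h subrr.
Qed.

(** Moving [T] across the inner product shows that both sides pair equally with every vector. *)
Lemma adjoint_ract (T S : X -> X) xi b :
  is_adjoint T S -> T (ract xi b) = ract (T xi) b.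
Proof.
move=> TS; apply: ip_ext => eta.
by rewrite ip_ract -ip_star TS ip_ractl starM starK -TS ip_star.
Qed.

Lemma lact_ract x (xi : X) b : lact x (ract xi b) = ract (lact x xi) b.
Proof.
by apply: (adjoint_ract (S := lact (star x))) => eta zeta; exact: lact_adj.
Qed.

(** By the C*-identity the difference [d] vanishes once [star d ** d] does, and the four terms of
    that product cancel in pairs. *)
Lemma representation_ract (D : cstarAlgType R) (pi : B -> D) (t : X -> D) xi b :
  representation pi t -> t (ract xi b) = t xi ** pi b.
Proof.
move=> [[piL piM piS] tL _ tip]; apply/eqP; rewrite -subr_eq0; apply/eqP/cstar_eq0.
have tipr eta : star (t eta) ** (t xi ** pi b) = star (t eta) ** t (ract xi b).
  by rewrite cmulA !tip ip_ract piM.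
rewrite cmul_subr star_sub !cmul_subl starM -!(cmulA (star (pi b))) !tipr.
by rewrite subrr.
Qed.

End Correspondences.

(** * Correspondences generated by a unit vector implementing an automorphism *)

Section UnitVector.
Variables (R : realType) (B : unitalCStarAlgType R) (X : correspondence B).
Variables (alpha : B -> B) (xi0 : X).
Hypothesis alpha_hom : star_hom alpha.
Hypothesis alpha_bij : bijective alpha.
Hypothesis ip_xi0 : ip xi0 xi0 = cone.
Hypothesis xi0_span : forall xi : X, xi = ract xi0 (ip xi0 xi).
Hypothesis lact_xi0 : forall x, lact x xi0 = ract xi0 (alpha x).

(** [alpha cone] is a unit for the range of [alpha], which is all of [B]. *)
Lemma automorphism_cone : alpha cone = cone.
Proof.
have [beta _ betaK] := alpha_bij; have [_ aM _] := alpha_hom.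
by rewrite -[LHS]cmulx1 -{2}(betaK cone) -aM cmul1x betaK.
Qed.

Lemma ip_xi0_lact x xi : ip xi0 (lact x xi) = alpha x ** ip xi0 xi.
Proof.
have [_ _ aS] := alpha_hom.
by rewrite -[x in LHS]starK -lact_adj lact_xi0 ip_ractl aS starK.
Qed.

Lemma lact_cone (xi : X) : lact cone xi = xi.
Proof.
by rewrite [LHS]xi0_span ip_xi0_lact automorphism_cone cmul1x -xi0_span.
Qed.

Lemma lact_theta x : lact x = theta (lact x xi0) xi0.
Proof. by apply/funext => xi; rewrite /theta -lact_ract -xi0_span. Qed.

(** By [lact_theta] the algebra acts by rank-one operators, and it acts faithfully because <xi0, y .
    xi0> = alpha(y). *)
Lemma katsura_idealT x : katsura_ideal X x.
Proof.
split=> [|y y0].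
  split; first by exists (lact (star x)); exact: lact_adj.
  move=> e e0; exists (lact x); split.
    exists [:: (lact x xi0, xi0)]; apply/funext => xi.
    by rewrite big_seq1 {1}lact_theta.
  move=> xi; rewrite /hnorm subrr.
  suff -> : ip (0 : X) 0 = 0 :> B.
    by rewrite normr0 sqrtC0 mulr_ge0 ?(ltW e0) // sqrtC_ge0.
  exact: lin_0 (ip_linear _).
have [aL _ _] := alpha_hom.
suff -> : y = 0 by rewrite cmul_0r.
apply: (bij_inj alpha_bij); rewrite (lin_0 aL) -[LHS]cmulx1 -ip_xi0.
by rewrite -ip_xi0_lact y0 (lin_0 (ip_linear _)).
Qed.

Section OfPair.
Variables (D : unitalCStarAlgType R) (pi : B -> D) (v : D).
Hypothesis pv : covariant_pair alpha pi v.

Definition rep_of_pair (xi : X) : D := star v ** pi (ip xi0 xi).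

Lemma pair_comm x : star v ** pi (alpha x) = pi x ** star v.
Proof.
by have [_ _ [vv _] va] := pv; rewrite -va !cmulA vv cmul1x.
Qed.

Lemma rep_of_pair_covariant : covariant_rep pi rep_of_pair.
Proof.
have [[piL piM piS] pi1 [v1 v2] _] := pv; split.
  split=> // [k xi eta|x xi|xi eta]; rewrite /rep_of_pair.
  - by rewrite ip_linear piL cmulDr cmulZr.
  - by rewrite ip_xi0_lact piM !cmulA pair_comm.
  - rewrite starM starK -cmulA (cmulA v) v2 cmul1x -piS -piM ip_star.
    by rewrite -ip_ract -xi0_span.
(* As [xi0] generates [X], an adjointable [T] is determined by the coefficient [ip xi0 (T xi0)];
   conjugating its image under [pi] by [v] gives psi_t. *)
exists (fun T => star v ** pi (ip xi0 (T xi0)) ** v).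
  split=> [k S T _ _|S T [[S' SS'] _] _|S T _ _ ST|xi eta] /=.
  - by rewrite ip_linear piL cmulDr cmulZr cmulDl cmulZl.
  - rewrite {1}[T xi0]xi0_span (adjoint_ract _ _ SS') ip_ract piM.
    by rewrite !cmulA -(cmulA _ v) v2 cmulx1.
  - by rewrite !starM starK -piS ip_star ST cmulA.
  - by rewrite /theta /rep_of_pair ip_ract piM starM starK -piS ip_star !cmulA.
move=> x _; rewrite lact_xi0 ip_ract ip_xi0 cmul1x pair_comm.
by rewrite -cmulA v1 -pi1 -piM cmulx1.
Qed.

End OfPair.

Section OfRep.
Variables (D : cstarAlgType R) (pi : B -> D) (t : X -> D).
Hypothesis pt : covariant_rep pi t.

(** Covariance applies to every [x], and [lact x] is rank one. At [x = cone] this becomes t(xi0)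
    t(xi0)^* = pi(1), one half of unitarity. *)
Lemma covariant_rep_xi0 x : pi x = t (lact x xi0) ** star (t xi0).
Proof.
have [_ [f [_ _ _ fth] fE]] := pt.
by rewrite (fE _ (katsura_idealT x)) [in LHS]lact_theta fth.
Qed.

Lemma rep_xi0_comm x : star (t xi0) ** pi x ** t xi0 = pi (alpha x).
Proof.
have [[_ _ tl ti] _] := pt.
by rewrite -cmulA tl ti lact_xi0 ip_ract ip_xi0 cmul1x.
Qed.

(** It suffices to check generators; on [t xi], the left unit law uses [lact_cone] and the right one
    the right linearity of [t]. *)
Lemma rep_unit : cstar_gen (range pi `|` range t) = [set: D] ->
  forall x, pi cone ** x = x /\ x ** pi cone = x.
Proof.
move=> gen x; have [rep _] := pt; have [[_ piM piS] _ tl _] := rep.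
apply: (@cstar_gen_unit _ _ (range pi `|` range t)); last by rewrite gen.
  by rewrite -piS star_cone.
move=> _ [[b _ <-]|[xi _ <-]]; first by rewrite -!piM cmul1x cmulx1.
by rewrite tl lact_cone -(representation_ract _ _ rep) ract1.
Qed.

End OfRep.

Lemma cuntz_pimsner_unit_vector (O : cstarAlgType R) (C : unitalCStarAlgType R) :
  is_cuntz_pimsner X O -> is_crossed_product alpha C -> star_isomorphic O C.
Proof.
move=> [pi [t [pt gen Ouniv]]] [iota [u [iu _ Cuniv]]].
(* Naming the unit allows [O] to be generalized together with it, then replaced by a unital
   structure with unit [p]. *)
have [p pE] : exists p, pi cone = p by exists (pi cone).
have unitO := rep_unit pt gen; rewrite pE in unitO.
have pl x := proj1 (unitO x); have pr x := proj2 (unitO x).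
move: O p pl pr pi t pE pt Ouniv {gen unitO}.
apply: unital_cstar_ind => O pi t pi1 pt Ouniv.
have [rep _] := pt; have [piH _ _ ti] := rep.
have tu : covariant_pair alpha pi (star (t xi0)).
  split=> //; last by move=> x; rewrite starK; exact: rep_xi0_comm.
  split; rewrite starK; last by rewrite ti ip_xi0 pi1.
  by rewrite -pi1 (covariant_rep_xi0 pt) lact_cone.
have [rho [[rhoH rhopi rhot] _]] := Ouniv C iota _ (rep_of_pair_covariant iu).
have [sigma [[sigmaH sigma1 sigmapi sigmau] _]] := Cuniv O pi _ tu.
(* Each composite fixes the generators, so the uniqueness clause of the matching universal property
   identifies it with the identity. *)
exists rho; split=> //; exists sigma => [x|x].
- have [r [_ runiq]] := Ouniv O pi t pt.
  rewrite -[RHS](congr1 (fun f => f x) (runiq id _)) //.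
  rewrite -[LHS](congr1 (fun f => f x) (runiq (sigma \o rho) _)) //; split=> /=.
  + exact: star_hom_comp.
  + by move=> y; rewrite rhopi sigmapi.
  + move=> xi; have [_ sM sS] := sigmaH.
    rewrite rhot sM sS sigmau sigmapi starK.
    by rewrite -[RHS](congr1 t (esym (xi0_span xi))) (representation_ract _ _ rep).
- have [r [_ runiq]] := Cuniv C iota u iu.
  have [_ iota1 _ _] := iu; have [_ _ rS] := rhoH.
  rewrite -[RHS](congr1 (fun f => f x) (runiq id _)) //.
  rewrite -[LHS](congr1 (fun f => f x) (runiq (rho \o sigma) _)) //; split=> /=.
  + exact: (star_hom_comp (D := O)).
  + by rewrite sigma1 -pi1 rhopi.
  + by move=> y; rewrite sigmapi rhopi.
  + by rewrite sigmau rS rhot /rep_of_pair ip_xi0 iota1 cmulx1 starK.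
Qed.

End UnitVector.

(** * The edge correspondence of an automorphism *)

Section MultiplicationAdjoint.
Variables (R : realType) (B : fdCStarAlgType R) (Q : finite_quantum_space B).
Local Notation psi := (fqs_psi Q).

Lemma psi_ext (a b : B) :
  (forall y, psi (star y ** a) = psi (star y ** b)) -> a = b.
Proof.
move=> h; apply/eqP; rewrite -subr_eq0; apply/eqP/(@fqs_faithful _ _ Q).
by rewrite cmul_subr linearB /= h subrr.
Qed.

(* [z] is the image of [star y] under the modular automorphism of [psi]. *)
Lemma psi_modular (y : B) : exists z, forall a, psi (star y ** a) = psi (a ** z).
Proof.
have [s sF] := frame_full (@psi_ipL _ _ Q) (@psi_ipC _ _ Q)
  (@psi_ip_ge0 _ _ Q) (@psi_ip_def _ _ Q).
(* Riesz representation: expand [star a] in the Parseval frame and take adjoints. *)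
exists (\sum_(f <- s) psi (star y ** star f) *: f) => a.
rewrite (lin_comb _ _ _ (cmul_linr a)) linear_sum.
rewrite -{1}[a]starK {1}(sF.2 (star a) (memvf _)).
rewrite (clin_comb (f := star)); last by move=> k b c; rewrite starD starZ.
rewrite (lin_comb _ _ _ (cmul_linr _)) linear_sum; apply: eq_bigr => f _ /=.
by rewrite !linearZ /= -(@psi_ipC _ _ Q) /psi_ip starK mulrC.
Qed.

Lemma psi_tip (T S : tensor B) : psi (tip psi T S) = ip_psi2 psi T S.
Proof.
rewrite /tip /ip_psi2 /tlift2 linear_sum; apply: eq_bigr => i _.
rewrite linear_sum; apply: eq_bigr => j _.
rewrite linear_sum; apply: eq_bigr => k _.
rewrite linear_sum; apply: eq_bigr => l _.
by rewrite linearZ /= linearZ.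
Qed.

Lemma tipZr k (T S : tensor B) : tip psi T (k *: S) = k *: tip psi T S.
Proof. exact: linear_scale (tip_lin _ _). Qed.

Lemma tipZl k (T S : tensor B) : tip psi (k *: T) S = k^* *: tip psi T S.
Proof. by rewrite -tip_star tipZr starZ tip_star. Qed.

Lemma tmul_lin : linear (@tmul R B).
Proof. exact: tlift_lin. Qed.

Lemma tmul_tract (T : tensor B) y : tmul (tract T y) = tmul T ** y.
Proof.
elim/tensor_ind: T => [|T S hT hS|a b].
- by rewrite (lin_0 (tract_linl _)) (lin_0 tmul_lin) cmul_0l.
- by rewrite (lin_add _ _ (tract_linl _)) !(lin_add _ _ tmul_lin) hT hS cmulDl.
- by rewrite tract_tens !tmul_tens cmulA.
Qed.

Lemma tmul_tlact (T : tensor B) x : tmul (tlact x T) = x ** tmul T.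
Proof.
elim/tensor_ind: T => [|T S hT hS|a b].
- by rewrite (lin_0 (tlact_linr _)) (lin_0 tmul_lin) cmul_0r.
- by rewrite (lin_add _ _ (tlact_linr _)) !(lin_add _ _ tmul_lin) hT hS cmulDr.
- by rewrite tlact_tens !tmul_tens cmulA.
Qed.

Local Notation M := (fqs_mstar Q cone).

(** Testing against [y] under [psi], the modular twist turns left multiplication by [star y] into a
    right action on [T]; the scalar adjunction defining m^* then applies. *)
Lemma tip_mstar T : tip psi M T = tmul T.
Proof.
apply: psi_ext => y; have [z yz] := psi_modular y.
rewrite !yz -tip_tract psi_tip fqs_mstar_adj star_cone cmul1x.
by rewrite tmul_tract.
Qed.

Lemma tip_ext (S S' : tensor B) :
  (forall T, tip psi S T = tip psi S' T) -> S = S'.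
Proof.
move=> h; apply/eqP; rewrite -subr_eq0; apply/eqP/(@psi_tip_def _ _ Q).
suff -> : tip psi (S - S') (S - S') = 0 by rewrite linear0.
(* Additivity in the left slot turns the difference into a sum once the pairing with [S'] is added
   back. *)
apply: (@addIr _ (tip psi S' (S - S'))).
by rewrite -tiplD subrK add0r h.
Qed.

(** Both sides pair with [T] to [star x ** tmul T]. *)
Lemma mstar_central x : tlact x M = tract M x.
Proof.
apply: tip_ext => T; rewrite tip_tlact tip_mstar tmul_tlact.
by rewrite -tip_star tip_tract starM tip_star tip_mstar.
Qed.

Section TmapHom.
Variables (alpha : B -> B) (alpha_hom : star_hom alpha).
Let aL : linear alpha. Proof. by case: alpha_hom. Qed.
Let aM : {morph alpha : x y / x ** y}. Proof. by case: alpha_hom. Qed.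
Let aS : {morph alpha : x / star x}. Proof. by case: alpha_hom. Qed.
Local Notation F := (tmap id alpha).
Let FL : linear F. Proof. exact: tlift_lin. Qed.

(** [alpha] acts on the second leg only, where the form is [star b ** d]; the scalar from the first
    leg passes through by linearity. *)
Lemma tip_tmap T S : tip psi (F T) (F S) = alpha (tip psi T S).
Proof.
elim/tensor_ind: T => [|T T' hT hT'|a b].
- by rewrite (lin_0 FL) !tipl0 (lin_0 aL).
- by rewrite (lin_add _ _ FL) !tiplD hT hT' (lin_add _ _ aL).
elim/tensor_ind: S => [|S S' hS hS'|c d].
- by rewrite (lin_0 FL) !(lin_0 (tip_lin _ _)) (lin_0 aL).
- by rewrite (lin_add _ _ FL) !(lin_add _ _ (tip_lin _ _)) hS hS' (lin_add _ _ aL).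
rewrite !tmap_tens // !tip_tens -aS -aM.
by rewrite linear_scale.
Qed.

Lemma tmap_tlact x T : F (tlact x T) = tlact x (F T).
Proof.
elim/tensor_ind: T => [|T T' hT hT'|a b].
- by rewrite (lin_0 FL) !(lin_0 (tlact_linr _)) (lin_0 FL).
- by rewrite (lin_add _ _ FL) !(lin_add _ _ (tlact_linr _)) (lin_add _ _ FL) hT hT'.
- by rewrite tlact_tens !tmap_tens // tlact_tens.
Qed.

Lemma tmap_tract y T : F (tract T y) = tract (F T) (alpha y).
Proof.
elim/tensor_ind: T => [|T T' hT hT'|a b].
- by rewrite (lin_0 FL) !(lin_0 (tract_linl _)) (lin_0 FL).
- by rewrite (lin_add _ _ FL) !(lin_add _ _ (tract_linl _)) (lin_add _ _ FL) hT hT'.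
- by rewrite tract_tens !tmap_tens // tract_tens aM.
Qed.

End TmapHom.

End MultiplicationAdjoint.

(** * The normalized generator of the edge correspondence *)

Section EdgeOfAutomorphism.
Variables (R : realType) (B : fdCStarAlgType R) (Q : finite_quantum_space B).
Variables (alpha : B -> B) (alpha_hom : star_hom alpha).
Hypothesis alpha_bij : bijective alpha.
Local Notation psi := (fqs_psi Q).
Local Notation G := (graph_of_hom Q alpha_hom).
Local Notation X := (edge_correspondence G).
Local Notation eps := (edge_vector G).
Local Notation delta := ((fqs_delta Q)%:C%C : R[i]).

Lemma edge_vector_mem : eps \in edge_space G.
Proof. by rewrite -[eps](tlact1) -[tlact _ _]tract1 mem_edge_gen. Qed.

Lemma delta_neq0 : delta != 0.
Proof. by rewrite gt_eqF // ltcR fqs_delta_gt0. Qed.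

Definition edge_unit : X := delta *: (Subvs edge_vector_mem : edge_sort G).

Lemma edge_vectorE :
  eps = (delta ^+ 2)^-1 *: tmap id alpha (fqs_mstar Q cone).
Proof.
by rewrite /edge_vector /= rmorphV ?rmorphXn // unitfE expf_neq0 // gt_eqF ?fqs_delta_gt0.
Qed.

Lemma scale_edge_vector : delta *: eps =
  delta^-1 *: tmap id alpha (fqs_mstar Q cone).
Proof.
rewrite edge_vectorE scalerA; congr (_ *: _).
by rewrite expr2 invfM mulrA divff ?delta_neq0 // mul1r.
Qed.

(** The pairing of m^*(1) with itself is m(m^*(1)) = delta^2, and [alpha] fixes the unit, so the
    factor 1/delta normalizes it. *)
Lemma ip_edge_unit : ip edge_unit edge_unit = cone.
Proof.
have [aL _ _] := alpha_hom.
rewrite /= /edge_ip /= scale_edge_vector tipZl tipZr tip_tmap // tip_mstar.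
rewrite fqs_delta_form (linear_scale _ _ aL) (automorphism_cone alpha_hom alpha_bij).
rewrite !scalerA rmorphXn /= conj_Creal; last first.
  by rewrite rpredV ger0_real // lecR ltW // fqs_delta_gt0.
by rewrite -expr2 -exprMn mulVf ?delta_neq0 // expr1n scale1r.
Qed.

(** m^*(1) is central, and applying [alpha] to the second leg keeps the left action but twists the
    right one by [alpha]. *)
Lemma lact_edge_unit x : lact x edge_unit = ract edge_unit (alpha x).
Proof.
apply: val_inj; rewrite /= scale_edge_vector.
rewrite (linear_scale _ _ (tlact_linr _)) (linear_scale _ _ (tract_linl _)).
by rewrite -tmap_tlact // mstar_central tmap_tract.
Qed.

Lemma edge_unit_span (xi : X) : xi = ract edge_unit (ip edge_unit xi).
Proof.
suff [b ->] : exists b, xi = ract edge_unit b.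
  by rewrite ip_ract ip_edge_unit cmul1x.
have /mem_edge_space[s sE] := subvsP (xi : edge_sort G).
(* Each x . eps . y equals [edge_unit] acted on by alpha(x) y / delta, since eps is [edge_unit]
   divided by delta. *)
pose b := \sum_(p <- s) delta^-1 *: (alpha p.1 ** p.2).
exists b; apply: val_inj; rewrite /= sE /b (lin_comb _ _ _ (tract_linr _)).
apply: eq_bigr => p _; have := congr1 val (lact_edge_unit p.1).
rewrite /= tractM => <-; rewrite scale_edge_vector edge_vectorE.
rewrite -!(linear_scale _ _ (tract_linl _)) -!(linear_scale _ _ (tlact_linr _)).
by rewrite scalerA expr2 invfM.
Qed.

End EdgeOfAutomorphism.

Theorem corollary4p13 (R : realType) (B : fdCStarAlgType R)
    (Q : finite_quantum_space B)
    (alpha : B -> B) (alpha_hom : star_hom alpha) (alpha_bij : bijective alpha)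
    (O : cstarAlgType R) (C : unitalCStarAlgType R)
    (hO : is_cuntz_pimsner (edge_correspondence (graph_of_hom Q alpha_hom)) O)
    (hC : is_crossed_product alpha C) :
  star_isomorphic O C.
Proof.
apply: (cuntz_pimsner_unit_vector alpha_hom alpha_bij
  (xi0 := edge_unit Q alpha_hom)) hO hC.
- exact: ip_edge_unit.
- exact: edge_unit_span.
- exact: lact_edge_unit.
Qed.
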